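(* Let $X$ be a non-empty set, and let $\Omega$ be an algebra of subsets of $X$. Let $A$ be an abelian group that has no elements of order 2. Suppose that $A$ is supplied with a translation invariant partial ordering such that $A^++A^+\subseteq A^+$, and with a bi-additive map $(a_1,a_2)\mapsto a_1a_2$ from $A\times A$ into $A$ such that $A^+A^+\subseteq A^+$. Let $\mu\colon\Omega\to A^+$ be a map such that $\mu(\emptyset)=0$, and $\mu\left(\bigcup_{i=1}^n\Delta_i\right)=\sum_{i=1}^n\mu(\Delta_i)$ whenever $\Delta_1,\dots,\Delta_n\in\Omega$ are pairwise disjoint. Then the following are equivalent: (1) $\mu(\Delta)^2=\mu(\Delta)$ for $\Delta\in\Omega$ and $\mu(\Delta_1)\mu(\Delta_2)=\mu(\Delta_2)\mu(\Delta_1)$ for $\Delta_1,\Delta_2\in\Omega$; (2) $\mu(\Delta_1\cap\Delta_2)=\mu(\Delta_1)\mu(\Delta_2)$ for $\Delta_1,\Delta_2\in\Omega$. Suppose that this is the case. Set ${}_{\mu(X)}A=\{a\in A:\mu(X)a=a\}$ and $A_{\mu(X)}=\{a\in A:a\mu(X)=a\}$. Then: (a) $\mu(\Omega)\subseteq{}_{\mu(X)}A\cap A_{\mu(X)}$; (b) for $\Delta_1,\Delta_2\in\Omega$, $\mu(\Delta_1)\vee\mu(\Delta_2)$ exists in ${}_{\mu(X)}A$, in $A_{\mu(X)}$, and in ${}_{\mu(X)}A\cap A_{\mu(X)}$; it equals $\mu(\Delta_1\cup\Delta_2)$ in all cases; (c) for $\Delta_1,\Delta_2\in\Omega$, $\mu(\Delta_1)\wedge\mu(\Delta_2)$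 exists in ${}_{\mu(X)}A$, in $A_{\mu(X)}$, in ${}_{\mu(X)}A\cap A_{\mu(X)}$, and in $\mu(\Omega)$; it equals $\mu(\Delta_1\cap\Delta_2)$ in all cases; (d) when supplied with the partial ordering inherited from $A$, the set $\mu(\Omega)$ is a Boolean algebra with largest element $\mu(X)$ and smallest element $0$; the complement of $a\in\mu(\Omega)$ is $\mu(X)-a$. The map $\mu\colon\Omega\to\mu(\Omega)$ is a homomorphism of Boolean algebras.
   Context: $A^+=\{a\in A:a\ge0\}$. The bi-additive product is not assumed to be associative or commutative. Subsets of $A$ carry the partial ordering inherited from $A$. *)

(* Defs.v *)
From HB Require Import structures.
From mathcomp Require Import all_boot all_order all_algebra.
From mathcomp Require Import all_classical.
From mathcomp Require Import measurable_structure.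

Set Implicit Arguments.
Unset Strict Implicit.
Unset Printing Implicit Defensive.
Import Order.TTheory GRing.Theory Num.Theory.
Local Open Scope classical_set_scope.
Local Open Scope ring_scope.

Definition set_algebra (X : Type) (Omega : set (set X)) : Prop :=
  [/\ Omega set0, setU_closed Omega & setC_closed Omega].

(* Subsets of a partially ordered type carry the inherited ordering, and the
   members of an algebra of sets are ordered by inclusion. *)
HB.instance Definition _ (T : choiceType) (S : set T) :=
  SubChoice.copy (set_type S) {x : T | x \in S}.
HB.instance Definition _ d (T : porderType d) (S : set T) :=
  [SubChoice_isSubPOrder of set_type S by <: with d].

(* The carrier is Omega; the proof that Omega is an algebra is a parameter so
   that the Boolean algebra structure below can be attached to the type. *)
Definition algebra_type (X : Type) (Omega : set (set X))
  (hO : set_algebra Omega) : Type := set_type Omega.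

Section AlgebraType.
Context (X : Type) (Omega : set (set X)) (hO : set_algebra Omega).
Local Notation B := (algebra_type hO).

HB.instance Definition _ := Order.POrder.copy B (set_type Omega).

Fact algebraU (x y : B) : val x `|` val y \in Omega.
Proof. by case: hO => _ hU _; rewrite inE; apply: hU; apply: set_valP. Qed.

Fact algebraC (x : B) : ~` val x \in Omega.
Proof. by case: hO => _ _ hC; rewrite inE; apply: hC; apply: set_valP. Qed.

Fact algebraI (x y : B) : val x `&` val y \in Omega.
Proof.
case: hO => _ hU hC; rewrite inE -[X in Omega X]setCK setCI.
by apply: (hC); apply: hU; apply: hC; apply: set_valP.
Qed.

Fact algebra0 : set0 \in Omega.
Proof. by case: hO => h0 _ _; rewrite inE. Qed.

Fact algebraT : setT \in Omega.
Proof. by case: hO => h0 _ hC; rewrite inE -setC0; exact: hC. Qed.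

Let join (x y : B) : B := SigSub (algebraU x y).
Let meet (x y : B) : B := SigSub (algebraI x y).
Let compl (x : B) : B := SigSub (algebraC x).
Let bot : B := SigSub algebra0.
Let top : B := SigSub algebraT.

Let meetP (x y z : B) : (x <= meet y z)%O = (x <= y)%O && (x <= z)%O.
Proof. exact: (@lexI _ (set X) (val x) (val y) (val z)). Qed.

Let joinP (x y z : B) : (join x y <= z)%O = (x <= z)%O && (y <= z)%O.
Proof. exact: (@leUx _ (set X) (val x) (val y) (val z)). Qed.

HB.instance Definition _ :=
  Order.POrder_MeetJoin_isLattice.Build set_display B meetP joinP.

Let meetUl : @left_distributive B B meet join.
Proof. by move=> x y z; apply: val_inj; exact: setIUl. Qed.

HB.instance Definition _ :=
  Order.Lattice_Meet_isDistrLattice.Build set_display B meetUl.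

Let botP (x : B) : (bot <= x)%O.
Proof. exact: (@le0x _ (set X) (val x)). Qed.

Let topP (x : B) : (x <= top)%O.
Proof. exact: (@lex1 _ (set X) (val x)). Qed.

HB.instance Definition _ := Order.hasBottom.Build set_display B botP.
HB.instance Definition _ := Order.hasTop.Build set_display B topP.

Let joinxC (x : B) : join x (compl x) = top.
Proof. by apply: val_inj; exact: setUv. Qed.

Let meetxC (x : B) : meet x (compl x) = bot.
Proof. by apply: val_inj; exact: setICr. Qed.

HB.instance Definition _ :=
  Order.TBDistrLattice_hasComplement.Build set_display B joinxC meetxC.

End AlgebraType.

Record boolean_morphism d d' (L : ctbDistrLatticeType d)
    (L' : ctbDistrLatticeType d') (f : L -> L') : Prop := BooleanMorphism {
  boolean_morphI : Order.meet_morphism f;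
  boolean_morphU : Order.join_morphism f;
  boolean_morph0 : f \bot%O = \bot%O;
  boolean_morph1 : f \top%O = \top%O;
  boolean_morphC : forall x, f (~` x)%O = (~` f x)%O }.

Definition corestrict_image (T U : Type) (S : set T) (f : T -> U) (x : S) :
    set_type (f @` S) :=
  SigSub (mem_set (imageP f (set_valP x))).

(* c is the supremum (infimum) of {a, b} formed inside the sub-poset S; by
   antisymmetry c is then unique. *)
Definition is_join_in d (T : porderType d) (S : set T) (a b c : T) : Prop :=
  [/\ S c, (a <= c)%O, (b <= c)%O &
      forall s, S s -> (a <= s)%O -> (b <= s)%O -> (c <= s)%O].

Definition is_meet_in d (T : porderType d) (S : set T) (a b c : T) : Prop :=
  [/\ S c, (c <= a)%O, (c <= b)%O &
      forall s, S s -> (s <= a)%O -> (s <= b)%O -> (s <= c)%O].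

(* Main.v *)
Require Import Defs.
From HB Require Import structures.
From mathcomp Require Import all_boot all_order all_algebra.
From mathcomp Require Import all_classical.
From mathcomp Require Import measurable_structure.

Set Implicit Arguments.
Unset Strict Implicit.
Unset Printing Implicit Defensive.
Import Order.TTheory Order.CTheory GRing.Theory Num.Theory.
Local Open Scope classical_set_scope.
Local Open Scope ring_scope.

(* Under (1), expanding mu(D1 U D2)^2 = mu(D1 U D2) for disjoint D1, D2 gives
   2 mu(D1) mu(D2) = 0, hence mu(D1) mu(D2) = 0; splitting D1 and D2 along their
   intersection then gives (2).  For an upper bound s of mu(D1), mu(D2) in
   {a : mu(X) a = a}, write s - mu(D1 U D2) = mu(X) (s - mu(D1 U D2)) and cut
   X into D1, D2 \ D1 and the remainder: each piece contributes a product of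
   positive elements.  Meets follow from joins through a |-> mu(X) - a, the
   statements on the right from those on the left by reversing the product, and
   the Boolean structure is transported from Omega along mu, because mu sends
   meets and joins to meets and joins. *)

(** * Transport of a Boolean algebra structure along a surjection onto a poset *)

Section SurjectiveImage.
Context d d' (L : ctbDistrLatticeType d) (T : porderType d').
Context (f : L -> T) (g : T -> L).
Context (gK : cancel g f).
Context (fI : forall x y z,
  (z <= f (x `&` y))%O = (z <= f x)%O && (z <= f y)%O).
Context (fU : forall x y z,
  (f (x `|` y) <= z)%O = (f x <= z)%O && (f y <= z)%O).

(* A copy of [T] that takes the hypotheses on [f] as parameters, so that the
   transported Boolean structure can be attached to it. *)
Definition surj_image of cancel g f
  & (forall x y z, (z <= f (x `&` y))%O = (z <= f x)%O && (z <= f y)%O)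
  & (forall x y z, (f (x `|` y) <= z)%O = (f x <= z)%O && (f y <= z)%O) : Type :=
  T.
Local Notation M := (surj_image gK fI fU).

HB.instance Definition _ := Order.POrder.copy M T.

Let meet (x y : M) : M := f (g x `&` g y)%O.
Let join (x y : M) : M := f (g x `|` g y)%O.
Let compl (x : M) : M := f (~` g x)%O.
Let bot : M := f \bot%O.
Let top : M := f \top%O.

Let meetP (x y z : M) : (x <= meet y z)%O = (x <= y)%O && (x <= z)%O.
Proof. by rewrite /meet [LHS]fI !gK. Qed.

Let joinP (x y z : M) : (join x y <= z)%O = (x <= z)%O && (y <= z)%O.
Proof. by rewrite /join [LHS]fU !gK. Qed.

HB.instance Definition _ :=
  Order.POrder_MeetJoin_isLattice.Build d' M meetP joinP.

Let h : L -> M := f.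

(** The operations on [M] go through the preimages chosen by [g]. By [fI] both sides are the infimum
    of [h x] and [h y], so the choice is immaterial. *)
Let hI x y : h (x `&` y)%O = meet (h x) (h y).
Proof. by apply/le_anti; rewrite meetP -!fI lexx /= fI -meetP lexx. Qed.

Let hU x y : h (x `|` y)%O = join (h x) (h y).
Proof. by apply/le_anti; rewrite joinP -!fU lexx /= fU -joinP lexx. Qed.

Let meetUl : @left_distributive M M meet join.
Proof.
move=> x y z; rewrite -(gK x) -(gK y) -(gK z) -!/(h _).
by rewrite -!(hI, hU) meetUl.
Qed.

HB.instance Definition _ := Order.Lattice_Meet_isDistrLattice.Build d' M meetUl.

Let botP (x : M) : (bot <= x)%O.
(* Joining [\bot] to [g x] changes nothing, so [fU] compares [f \bot] with [f (g x)], which is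
   [x]. *)
Proof. by have := fU \bot%O (g x) x; rewrite join0x gK lexx => /esym/andP[]. Qed.

Let topP (x : M) : (x <= top)%O.
Proof. by have := fI \top%O (g x) x; rewrite meet1x gK lexx => /esym/andP[]. Qed.

HB.instance Definition _ := Order.hasBottom.Build d' M botP.
HB.instance Definition _ := Order.hasTop.Build d' M topP.

Let joinxC (x : M) : join x (compl x) = top.
Proof.
by rewrite -[in X in join X _](gK x) -[LHS]/(join (h _) (h _)) -hU joinxC.
Qed.

Let meetxC (x : M) : meet x (compl x) = bot.
Proof.
by rewrite -[in X in meet X _](gK x) -[LHS]/(meet (h _) (h _)) -hI meetxC.
Qed.

HB.instance Definition _ :=
  Order.TBDistrLattice_hasComplement.Build d' M joinxC meetxC.

(** For complements: the images of an element and of its complement meet in [\bot] and join to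
    [\top], and each of these facts gives one inequality. *)
Lemma surj_image_boolean_morphism : boolean_morphism (f : L -> M).
Proof.
split=> // x; rewrite -/(h _) -[f x]/(h x); apply/le_anti/andP; split.
  by rewrite -disj_leC -[X in X == _]hI meetCx.
rewrite -[X in (_ <= X)%O]complK -disj_leC -complU.
have -> : (h x `|` h (~` x) = \top)%O by rewrite joinC -[LHS]hU joinCx.
by rewrite compl1.
Qed.

End SurjectiveImage.

(** In a smaller sub-poset fewer upper bounds compete, so a supremum survives as long as it stays
    inside. *)
Lemma is_join_in_sub d (T : porderType d) (S S' : set T) (a b c : T) :
  S `<=` S' -> S c -> is_join_in S' a b c -> is_join_in S a b c.
Proof. by move=> SS' Sc [_ ac bc minc]; split=> // s /SS'; apply: minc. Qed.

Lemma is_meet_in_sub d (T : porderType d) (S S' : set T) (a b c : T) :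
  S `<=` S' -> S c -> is_meet_in S' a b c -> is_meet_in S a b c.
Proof. by move=> SS' Sc [_ ca cb maxc]; split=> // s /SS'; apply: maxc. Qed.

(** * Closure properties of an algebra of sets, and additivity on two sets *)

Section SetAlgebra.
Context (X : Type) (Omega : set (set X)) (Omega_algebra : set_algebra Omega).

Lemma set_algebra0 : Omega set0.
Proof. by case: Omega_algebra. Qed.

Lemma set_algebraC D : Omega D -> Omega (~` D).
Proof. by case: Omega_algebra => _ _; apply. Qed.

Lemma set_algebraU D E : Omega D -> Omega E -> Omega (D `|` E).
Proof. by case: Omega_algebra => _ OU _; apply: OU. Qed.

Lemma set_algebraT : Omega setT.
Proof. by rewrite -setC0; apply: set_algebraC; apply: set_algebra0. Qed.

Lemma set_algebraI D E : Omega D -> Omega E -> Omega (D `&` E).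
Proof.
move=> OD OE; rewrite -[D `&` E]setCK setCI.
by apply: set_algebraC; apply: set_algebraU; apply: set_algebraC.
Qed.

Lemma set_algebraD D E : Omega D -> Omega E -> Omega (D `\` E).
Proof. by move=> OD OE; rewrite setDE; apply/set_algebraI/set_algebraC. Qed.

End SetAlgebra.

Lemma fin_additiveU (X : Type) (Omega : set (set X)) (A : zmodType)
    (mu : set X -> A) :
  (forall (n : nat) (D : 'I_n -> set X), (forall i, Omega (D i)) ->
     trivIset setT D -> mu (\bigcup_i D i) = \sum_(i < n) mu (D i)) ->
  forall D E, Omega D -> Omega E -> D `&` E = set0 ->
    mu (D `|` E) = mu D + mu E.
Proof.
move=> mu_additive D E OD OE DE0.
pose F (i : 'I_2) := if i == ord0 then D else E.
have -> : D `|` E = \bigcup_i F i.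
  apply/seteqP; split=> [x [Dx|Ex]|x [i _]].
  - by exists ord0.
  - by exists (Ordinal (isT : 1 < 2)%N).
  - by rewrite /F; case: ifP => _; [left|right].
rewrite mu_additive ?big_ord_recl ?big_ord0 ?addr0 //.
  by move=> i; rewrite /F; case: ifP.
move=> i j _ _; rewrite /F.
case: (eqVneq i ord0) => [->|i0]; case: (eqVneq j ord0) => [->|j0] //.
- by rewrite DE0 => /set0P/eqP.
- by rewrite setIC DE0 => /set0P/eqP.
(* Neither index is [ord0], so both are the other element of ['I_2]. *)
- move=> _; apply/val_inj; move: i0 j0.
  by case: i j => [[|[|i]]] //= ? [[|[|j]]].
Qed.

(** * Positive additive set functions with values in an ordered group *)

Section AdditiveMeasure.
Context (X : Type) (Omega : set (set X)) (Omega_algebra : set_algebra Omega).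
Context (A : porderZmodType).
Context (le_translation : forall a b c : A, a <= b -> a + c <= b + c).
Context (pos_add : forall a b : A, 0 <= a -> 0 <= b -> 0 <= a + b).
Context (mu : set X -> A).
Context (mu_pos : forall D, Omega D -> 0 <= mu D) (mu0 : mu set0 = 0).
Context (mu_addU : forall D E, Omega D -> Omega E -> D `&` E = set0 ->
  mu (D `|` E) = mu D + mu E).

Let OT := set_algebraT Omega_algebra.
Let OC := set_algebraC Omega_algebra.
Let OU := set_algebraU Omega_algebra.
Let OI := set_algebraI Omega_algebra.
Let OD := set_algebraD Omega_algebra.

Lemma translation_subr_ge0 (a b : A) : (0 <= b - a) = (a <= b).
Proof.
apply/idP/idP => [/(le_translation a)|/(le_translation (- a))].
  by rewrite add0r subrK.
by rewrite subrr.
Qed.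

Lemma add_measureID D E : Omega D -> Omega E ->
  mu D = mu (D `&` E) + mu (D `\` E).
Proof.
move=> hD hE; rewrite -[in LHS](setUIDK D E) mu_addU//; first exact: OI.
  exact: OD.
by rewrite setDE setIACA setICr setI0.
Qed.

Lemma add_measureC D : Omega D -> mu (~` D) = mu setT - mu D.
Proof.
by move=> hD; rewrite (add_measureID OT hD) setTI setTD addrAC subrr add0r.
Qed.

Lemma add_measure_homo D E : Omega D -> Omega E -> D `<=` E -> mu D <= mu E.
Proof.
move=> hD hE DE; rewrite (add_measureID hE hD) setIidr //.
by rewrite -translation_subr_ge0 addrAC subrr add0r mu_pos//; apply: OD.
Qed.

(** * Multiplicativity, and suprema and infima among the fixed elements *)

Section Product.
Context (mul : A -> A -> A).
Context (mul_addl : left_distributive mul +%R).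
Context (mul_addr : right_distributive mul +%R).
Context (pos_mul : forall a b : A, 0 <= a -> 0 <= b -> 0 <= mul a b).

Lemma mul_subr a b c : mul a (b - c) = mul a b - mul a c.
Proof. by apply: (addIr (mul a c)); rewrite -mul_addr !subrK. Qed.

Lemma idempotent_commuting_multiplicative
  (no_order2 : forall a : A, a != 0 -> a + a != 0)
  (mu_idem : forall D, Omega D -> mul (mu D) (mu D) = mu D)
  (mu_comm : forall D E, Omega D -> Omega E ->
    mul (mu D) (mu E) = mul (mu E) (mu D)) D E :
  Omega D -> Omega E -> mu (D `&` E) = mul (mu D) (mu E).
Proof.
have mul_disj F G : Omega F -> Omega G -> F `&` G = set0 ->
    mul (mu F) (mu G) = 0.
  move=> hF hG FG0; apply/eqP/contraT => /no_order2/eqP; case.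
  (* Cancelling [mu F + mu G] in the expanded square leaves twice the product of [mu F] and
     [mu G]. *)
  have := mu_idem _ (OU hF hG).
  rewrite mu_addU// mul_addl !mul_addr !mu_idem// (mu_comm G F)//.
  rewrite [mu F + _]addrC addrACA => /(canRL (addrK _)) ->.
  by rewrite subrr.
move=> hD hE; have hDE := OI hD hE.
(* Of the four products, only the square of [mu (D]&[E)] does not come from disjoint sets. *)
rewrite [in RHS](add_measureID hD hE) [in RHS](add_measureID hE hD).
rewrite mul_addl !mul_addr [E `&` D]setIC mu_idem// !mul_disj ?addr0//.
all: try exact: OD.
all: by apply/seteqP; split=> // x /=; tauto.
Qed.

Context (mu_mul : forall D E, Omega D -> Omega E ->
  mu (D `&` E) = mul (mu D) (mu E)).

Let lA := [set a : A | mul (mu setT) a = a].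

Lemma mul_measure_fixed D : Omega D -> lA (mu D).
Proof. by move=> hD; rewrite /lA /= -mu_mul ?setTI. Qed.

Lemma mul_measure_join D E : Omega D -> Omega E ->
  is_join_in lA (mu D) (mu E) (mu (D `|` E)).
Proof.
move=> hD hE; have hDE := OU hD hE; split.
- exact: mul_measure_fixed.
- exact: (add_measure_homo _ _ (@subsetUl _ _ _)).
- exact: (add_measure_homo _ _ (@subsetUr _ _ _)).
move=> s sA Ds Es; rewrite -translation_subr_ge0.
(* On a piece F where [D `|` E] agrees with G, [mu (D `|` E)] may be replaced by
   [mu G], which is below s. *)
have piece F G : Omega F -> Omega G -> F `&` (D `|` E) = F `&` G ->
    mu G <= s -> 0 <= mul (mu F) (s - mu (D `|` E)).
  move=> hF hG FG Gs; rewrite mul_subr -mu_mul// FG mu_mul// -mul_subr.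
  by apply: pos_mul; rewrite ?mu_pos ?translation_subr_ge0.
(* Positivity of [s] is phrased with [mu set0] because [piece] is applied with [G] empty outside the
   union. *)
have s_ge0 : mu set0 <= s by rewrite mu0; apply: le_trans Ds; apply: mu_pos.
have -> : s - mu (D `|` E) = mul (mu setT) (s - mu (D `|` E)).
  by rewrite mul_subr sA mul_measure_fixed.
rewrite (add_measureID OT hDE) (add_measureID (OI OT hDE) hD) !mul_addl.
apply: pos_add; first apply: pos_add.
- apply: (piece _ D) => //; first exact/OI/hD/OI.
  by rewrite setTI; apply/seteqP; split=> x /=; tauto.
- apply: (piece _ E) => //; first exact/OD/hD/OI.
  by rewrite setTI; apply/seteqP; split=> x /=; tauto.
- apply: (piece _ set0) => //; [exact: OD|exact: set_algebra0 Omega_algebra|].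
  by apply/seteqP; split=> x /=; tauto.
Qed.

Lemma mul_measure_meet D E : Omega D -> Omega E ->
  is_meet_in lA (mu D) (mu E) (mu (D `&` E)).
Proof.
move=> hD hE; have hDE := OI hD hE; split.
- exact: mul_measure_fixed.
- exact: (add_measure_homo _ _ (@subIsetl _ _ _)).
- exact: (add_measure_homo _ _ (@subIsetr _ _ _)).
(* Subtraction from [mu setT] reverses the order, so a lower bound [s] in [lA] becomes an upper
   bound in [lA] for the complements. *)
have sub_swap F s : Omega F -> (mu (~` F) <= mu setT - s) = (s <= mu F).
  move=> hF; rewrite add_measureC// -translation_subr_ge0.
  by rewrite opprB addrC addrA subrK translation_subr_ge0.
move=> s sA; rewrite -!sub_swap// setCI.
case: (mul_measure_join (OC hD) (OC hE)) => _ _ _; apply.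
by rewrite /lA /= mul_subr sA mul_measure_fixed.
Qed.

End Product.
End AdditiveMeasure.

(** * The equivalence, the lattice operations and the Boolean algebra of values *)

Theorem proposition3p1
  (X : Type) (X_nonempty : [set: X] !=set0)
  (Omega : set (set X)) (Omega_algebra : set_algebra Omega)
  (A : porderZmodType)
  (no_order2 : forall a : A, a != 0 -> a + a != 0)
  (le_translation : forall a b c : A, a <= b -> a + c <= b + c)
  (pos_add : forall a b : A, 0 <= a -> 0 <= b -> 0 <= a + b)
  (mul : A -> A -> A)
  (mul_addl : left_distributive mul +%R)
  (mul_addr : right_distributive mul +%R)
  (pos_mul : forall a b : A, 0 <= a -> 0 <= b -> 0 <= mul a b)
  (mu : set X -> A)
  (mu_pos : forall D, Omega D -> 0 <= mu D)
  (mu0 : mu set0 = 0)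
  (mu_additive : forall (n : nat) (D : 'I_n -> set X),
     (forall i, Omega (D i)) -> trivIset setT D ->
     mu (\bigcup_i D i) = \sum_(i < n) mu (D i)) :
  let cond1 :=
    (forall D, Omega D -> mul (mu D) (mu D) = mu D) /\
    (forall D1 D2, Omega D1 -> Omega D2 ->
       mul (mu D1) (mu D2) = mul (mu D2) (mu D1)) in
  let cond2 :=
    forall D1 D2, Omega D1 -> Omega D2 ->
      mu (D1 `&` D2) = mul (mu D1) (mu D2) in
  let lA := [set a : A | mul (mu setT) a = a] in
  let Ar := [set a : A | mul a (mu setT) = a] in
  (cond1 <-> cond2) /\
  (cond2 ->
   [/\ mu @` Omega `<=` lA `&` Ar,
       forall D1 D2, Omega D1 -> Omega D2 ->
         [/\ is_join_in lA (mu D1) (mu D2) (mu (D1 `|` D2)),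
             is_join_in Ar (mu D1) (mu D2) (mu (D1 `|` D2)) &
             is_join_in (lA `&` Ar) (mu D1) (mu D2) (mu (D1 `|` D2))],
       forall D1 D2, Omega D1 -> Omega D2 ->
         [/\ is_meet_in lA (mu D1) (mu D2) (mu (D1 `&` D2)),
             is_meet_in Ar (mu D1) (mu D2) (mu (D1 `&` D2)),
             is_meet_in (lA `&` Ar) (mu D1) (mu D2) (mu (D1 `&` D2)) &
             is_meet_in (mu @` Omega) (mu D1) (mu D2) (mu (D1 `&` D2))] &
       (* a Boolean algebra structure on the set mu(Omega) itself, whose order
          is the one inherited from A *)
       exists B : Order.CTBDistrLattice.axioms_ ring_display
                    (set_type (mu @` Omega)),
         let L := Order.CTBDistrLattice.Pack B in
         [/\ forall x y : L, (x <= y)%O = (val x <= val y),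
             val (\top%O : L) = mu setT,
             val (\bot%O : L) = 0,
             forall x : L, val (~` x)%O = mu setT - val x &
             boolean_morphism
               (corestrict_image mu : algebra_type Omega_algebra -> L)]]).
Proof.
move=> cond1 cond2 lA Ar.
have mu_addU := fin_additiveU mu_additive.
have OT := set_algebraT Omega_algebra.
have OU := set_algebraU Omega_algebra.
have OI := set_algebraI Omega_algebra.
split.
  split=> [[mu_idem mu_comm] D E|mu_mul].
    exact: (idempotent_commuting_multiplicative Omega_algebra mu_addU).
  split=> [D OD|D E OD OE]; first by rewrite -mu_mul// setIid.
  by rewrite -!mu_mul// setIC.
move=> mu_mul.
(* The set [Ar] is the set [lA] of the opposite product, which satisfies the same hypotheses;
   multiplicativity carries over since intersection is commutative. *)
pose rmul a b := mul b a.
have rmul_addl : left_distributive rmul +%R by move=> *; apply: mul_addr.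
have rmul_addr : right_distributive rmul +%R by move=> *; apply: mul_addl.
have pos_rmul a b : 0 <= a -> 0 <= b -> 0 <= rmul a b.
  by move=> a0 b0; apply: pos_mul.
have mu_rmul D E : Omega D -> Omega E ->
    mu (D `&` E) = rmul (mu D) (mu E).
  by move=> OD OE; rewrite setIC mu_mul.
have im_lA : mu @` Omega `<=` lA.
  by move=> _ [D OD <-]; apply: (mul_measure_fixed Omega_algebra mu_mul).
have im_Ar : mu @` Omega `<=` Ar.
  move=> _ [D OD <-].
  exact: (mul_measure_fixed Omega_algebra mu_rmul).
have im_lAr : mu @` Omega `<=` lA `&` Ar.
  by move=> a im_a; split; [apply: im_lA|apply: im_Ar].
have joins D E : Omega D -> Omega E ->
    is_join_in lA (mu D) (mu E) (mu (D `|` E)) /\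
    is_join_in Ar (mu D) (mu E) (mu (D `|` E)).
  move=> OD OE.
  have mul_join := mul_measure_join Omega_algebra le_translation pos_add
    mu_pos mu0 mu_addU.
  split; first exact: mul_join mul_addl mul_addr pos_mul mu_mul _ _ OD OE.
  exact: mul_join rmul_addl rmul_addr pos_rmul mu_rmul _ _ OD OE.
have meets D E : Omega D -> Omega E ->
    is_meet_in lA (mu D) (mu E) (mu (D `&` E)) /\
    is_meet_in Ar (mu D) (mu E) (mu (D `&` E)).
  move=> OD OE.
  have mul_meet := mul_measure_meet Omega_algebra le_translation pos_add
    mu_pos mu0 mu_addU.
  split; first exact: mul_meet mul_addl mul_addr pos_mul mu_mul _ _ OD OE.
  exact: mul_meet rmul_addl rmul_addr pos_rmul mu_rmul _ _ OD OE.
have im D : Omega D -> (mu @` Omega) (mu D) by move=> OD; exists D.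
(* Suprema inside the image are what [fU] below requires. *)
have im_joins D E : Omega D -> Omega E ->
    is_join_in (mu @` Omega) (mu D) (mu E) (mu (D `|` E)).
  move=> OD OE; apply: (is_join_in_sub im_lA); first exact/im/OU.
  by case: (joins D E).
have im_meets D E : Omega D -> Omega E ->
    is_meet_in (mu @` Omega) (mu D) (mu E) (mu (D `&` E)).
  move=> OD OE; apply: (is_meet_in_sub im_lA); first exact/im/OI.
  by case: (meets D E).
split=> //.
- move=> D E OD OE; have [lD rD] := joins _ _ OD OE; split=> //.
  by apply: (is_join_in_sub (@subIsetl _ _ _)) lD; apply/im_lAr/im/OU.
- move=> D E OD OE; have [lD rD] := meets _ _ OD OE; split=> //.
    by apply: (is_meet_in_sub (@subIsetl _ _ _)) lD; apply/im_lAr/im/OI.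
  exact: im_meets.
pose f : algebra_type Omega_algebra -> set_type (mu @` Omega) :=
  corestrict_image mu.
(* The sigma type, obtained by choice, lets [g] be a function picking preimages. *)
have f_surj y : {x | f x = y}.
  apply: cid; have [D OD Dy] := set_valP y.
  by exists (SigSub (mem_set OD)); apply: val_inj.
pose g y := sval (f_surj y).
have gK : cancel g f by move=> y; exact: svalP (f_surj y).
have fI x y z : (z <= f (x `&` y) = (z <= f x) && (z <= f y))%O.
  have [_ mux muy maxmu] := im_meets _ _ (set_valP x) (set_valP y).
  apply/idP/andP => [zxy|[zx zy]]; last exact: maxmu (set_valP z) zx zy.
  by split; apply: (le_trans zxy).
have fU x y z : (f (x `|` y) <= z = (f x <= z) && (f y <= z))%O.
  have [_ mux muy minmu] := im_joins _ _ (set_valP x) (set_valP y).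
  apply/idP/andP => [xyz|[xz yz]]; last exact: minmu (set_valP z) xz yz.
  by split; apply: le_trans xyz.
(* Since [surj_image] unfolds to its carrier, this class is a structure on the image itself, with
   the inherited order. *)
exists (Order.CTBDistrLattice.class (surj_image gK fI fU)) => L.
have fL : boolean_morphism (f : algebra_type Omega_algebra -> L).
  exact: surj_image_boolean_morphism.
pose v (x : L) := val (x : set_type (mu @` Omega)).
split=> //.
(* Writing [x] as [f (g x)] turns its complement into the value of [mu] at the complement of
   [g x]. *)
move=> x; rewrite -[x]gK.
apply: etrans (esym (congr1 v (boolean_morphC fL (g x)))) _.
exact: (add_measureC Omega_algebra mu_addU (set_valP (g x))).
Qed.
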